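(* Let $\Omega\subset\mathbb{R}^n$ be a bounded Lipschitz domain, $T>0$, $\Omega_T=(0,T]\times\Omega$, $W$ a Hilbert space of measurable functions on $\Omega_T$ continuously embedded in $L^2(0,T;L^2(\Omega))$, $y_0\in L^2(\Omega)$, and $S:L^2(0,T;\mathbb{R}^2)\to W$ a continuous affine map with $\|S(u)\|_W\le C(\|u\|_{L^2(0,T;\mathbb{R}^2)}+\|y_0\|_{L^2(\Omega)})$ for a constant $C$ independent of $u,y_0$; let $S_0$ be its linear part (the map $S$ with $y_0=0$). Let $\omega_{\mathrm{obs}}\subset\Omega$, $y^d\in L^2(0,T;L^2(\omega_{\mathrm{obs}}))$, $\beta>\alpha>0$, and suppose either (i) $\mathcal{U}=H^1(0,T;\mathbb{R}^2)$ and $\varepsilon>0$, or (ii) $\mathcal{U}$ is a finite-dimensional subspace of $L^2(0,T;\mathbb{R}^2)$ and $\varepsilon=0$. Let $\bar u\in\mathcal{U}$ be a local minimizer over $\mathcal{U}$ of $$J_\beta(u)=\frac12\|Su-y^d\|^2_{L^2(0,T;L^2(\omega_{\mathrm{obs}}))}+\frac\alpha2\|u\|^2_{L^2(0,T;\mathbb{R}^2)}+\frac\varepsilon2\|u_t\|^2_{L^2(0,T;\mathbb{R}^2)}+\beta\int_0^T|u_1(t)u_2(t)|\,dt.$$ Then $$0\in S_0^*(S\bar u-y^d)+\alpha\bar u-\varepsilon\bar u_{tt}+\beta\,\mathrm{sign}(\bar u_1\bar u_2)\begin{pmatrix}\bar u_2\\ \bar u_1\end{pmatrix},$$ understood as a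 subset of $\mathcal{U}^*$; that is, there exists $q\in L^\infty(0,T)$ with $q(t)\in\beta\,\mathrm{sign}(\bar u_1(t)\bar u_2(t))$ for a.e. $t$ such that for all $v\in\mathcal{U}$, $$(S_0v,S\bar u-y^d)_{L^2(0,T;L^2(\omega_{\mathrm{obs}}))}+\alpha(\bar u,v)_{L^2(0,T;\mathbb{R}^2)}+\varepsilon(\bar u_t,v_t)_{L^2(0,T;\mathbb{R}^2)}+\int_0^T q\,(\bar u_2v_1+\bar u_1v_2)\,dt=0.$$
   Context: $Su=S(u)$ is the state for control $u=(u_1,u_2)$, restricted to $(0,T)\times\omega_{\mathrm{obs}}$ in the tracking term; $S_0^*$ is the adjoint of $S_0$ regarded as a map into $L^2(0,T;L^2(\omega_{\mathrm{obs}}))$. The set-valued sign is $\mathrm{sign}(s)=\{1\}$ for $s>0$, $\{-1\}$ for $s<0$, $[-1,1]$ for $s=0$, applied pointwise. The term $-\varepsilon\bar u_{tt}$ is understood weakly, i.e. as $v\mapsto\varepsilon(\bar u_t,v_t)$. *)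

(* Defs.v *)
From HB Require Import structures.
From mathcomp Require Import all_boot all_order all_algebra.
From mathcomp Require Import all_classical all_reals all_analysis.
Set Implicit Arguments. Unset Strict Implicit. Unset Printing Implicit Defensive.
Import Order.TTheory GRing.Theory Num.Theory.
Import numFieldNormedType.Exports.
Local Open Scope classical_set_scope.
Local Open Scope ring_scope.

Section Defs.
Context {R : realType}.

Definition ctrl := ((R -> R) * (R -> R))%type.

Definition ctrl_add (u v : ctrl) : ctrl := (fun t => u.1 t + v.1 t, fun t => u.2 t + v.2 t).
Definition ctrl_scale (a : R) (u : ctrl) : ctrl := (fun t => a * u.1 t, fun t => a * u.2 t).
Definition ctrl_sub (u v : ctrl) : ctrl := (fun t => u.1 t - v.1 t, fun t => u.2 t - v.2 t).
Definition ctrl_zero : ctrl := (fun _ => 0, fun _ => 0).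

Definition tI (T : R) : set R := `[0, T]%classic.

Definition L2f (T : R) (f : R -> R) : Prop :=
  measurable_fun (tI T) f /\
  (@lebesgue_measure R).-integrable (tI T) (fun t => ((f t) ^+ 2)%:E).

Definition L2c (T : R) (u : ctrl) : Prop := L2f T u.1 /\ L2f T u.2.

Definition ipT (T : R) (f g : R -> R) : R :=
  \int[@lebesgue_measure R]_(t in tI T) (f t * g t).
Definition ipc (T : R) (u v : ctrl) : R := ipT T u.1 v.1 + ipT T u.2 v.2.
Definition normc2 (T : R) (u : ctrl) : R := ipc T u u.

Definition testfun (T : R) (phi : R -> R) : Prop :=
  (forall (n : nat) (x : R), derivable (derive1n n phi) x 1) /\
  exists a b : R, [/\ 0 < a, a < b, b < T &
     forall x, x < a \/ b < x -> phi x = 0].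

Definition is_wderiv (T : R) (f g : R -> R) : Prop :=
  [/\ L2f T f, L2f T g &
    forall phi, testfun T phi ->
      \int[@lebesgue_measure R]_(t in tI T) (f t * (derive1 phi) t)
      = - \int[@lebesgue_measure R]_(t in tI T) (g t * phi t)].

Definition H1c (T : R) (u du : ctrl) : Prop :=
  is_wderiv T u.1 du.1 /\ is_wderiv T u.2 du.2.

Definition in_beta_sign (beta s y : R) : Prop :=
  exists z : R, y = beta * z /\
    [/\ 0 < s -> z = 1, s < 0 -> z = -1 & s = 0 -> -1 <= z <= 1].

Definition in_span (T : R) (m : nat) (e : 'I_m -> ctrl) (u : ctrl) : Prop :=
  L2c T u /\ exists c : 'I_m -> R,
    {ae @lebesgue_measure R, forall t, tI T t ->
       u.1 t = \sum_(k < m) c k * (e k).1 t /\ u.2 t = \sum_(k < m) c k * (e k).2 t}.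

Section Obs.
Context {d : measure_display} {X : measurableType d}
        (muX : {measure set X -> \bar R}).

(** L^2 of the observation space ((0,T) x omega_obs in the paper) *)
Definition L2X (f : X -> R) : Prop :=
  measurable_fun setT f /\ muX.-integrable setT (fun x => ((f x) ^+ 2)%:E).

Definition ipX (f g : X -> R) : R := \int[muX]_x (f x * g x).

(** the reduced cost J_beta(u) with time derivative du = u_t *)
Definition Jbeta (T : R) (S : ctrl -> X -> R) (yd : X -> R)
    (alpha eps beta : R) (u du : ctrl) : R :=
  2^-1 * ipX (fun x => S u x - yd x) (fun x => S u x - yd x)
  + alpha / 2 * normc2 T u + eps / 2 * normc2 T du
  + beta * \int[@lebesgue_measure R]_(t in tI T) `|u.1 t * u.2 t|.
End Obs.

End Defs.

(* Main.v *)
(* Let l(v) = u_2 v_1 + u_1 v_2 and let A(v) be the derivative at u in direction v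
   of the quadratic part of the cost.  Minimality along u + s v, divided by
   s -> 0+, gives A(v) + P(l(v)) >= 0, where P f is the integral of
   max (lo f) (hi f) and [lo, hi] is the interval beta sign(u_1 u_2).
   P is sublinear on L^1(0,T), so by Hahn-Banach there is a linear F <= P on L^1
   with F(l(v)) = - A(v).  Since F is L^1-bounded, B |-> F(1_B) is a charge
   absolutely continuous with respect to Lebesgue measure; its Radon-Nikodym
   density is the multiplier q, and F <= P forces lo <= q <= hi. *)
Require Import Defs.
From HB Require Import structures.
From mathcomp Require Import all_boot all_order all_algebra.
From mathcomp Require Import all_classical all_reals all_analysis.
From mathcomp Require Import measurable_realfun ring lra.
Import Order.TTheory GRing.Theory Num.Theory.
Import numFieldNormedType.Exports HBSimple HBNNSimple.
Local Open Scope classical_set_scope.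
Local Open Scope ring_scope.
Set Implicit Arguments.
Unset Strict Implicit.
Unset Printing Implicit Defensive.

(** * Sublinear functionals *)

(** For each direction [v] the inequality yields a selection of the sign adapted to that [v]; one
    selection has to serve all directions at once, and Hahn-Banach provides this uniformity. L^1 is
    the space to work in because [l(v)] is a sum of products of L^2 functions, and its functionals
    are the bounded multipliers. The pairs [(l(v), A(v))] are kept as a relation, so that [A(v)]
    never has to be shown to depend on [l(v)] alone. The elements are genuine functions, not
    classes: Hahn-Banach is therefore stated relative to a linear subset [D] of the module of all
    functions, and insensitivity to null sets has to be derived from the L^1 bound. Both control
    spaces are handled as linear families of pairs [(v, v_t)], the second entry being zero in the
    finite-dimensional case. *)

Section Sublinear.
Context {R : realType} {V : lmodType R}.
Variable D : set V.
Implicit Types (p q F : V -> R) (f g : V) (K : set (V * R)).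

Definition sublinear_on p :=
  (forall f g, D f -> D g -> p (f + g) <= p f + p g) /\
  (forall a f, 0 <= a -> D f -> p (a *: f) <= a * p f).

Definition linear_on F :=
  (forall f g, D f -> D g -> F (f + g) = F f + F g) /\
  (forall a f, D f -> F (a *: f) = a * F f).

Hypotheses (D0 : D 0) (D_lin : forall a f g, D f -> D g -> D (a *: f + g)).

Let DZ a f : D f -> D (a *: f).
Proof. by move=> Df; rewrite -[_ *: _]addr0; exact: D_lin. Qed.

Let DD f g : D f -> D g -> D (f + g).
Proof. by move=> Df Dg; rewrite -[f]scale1r; exact: D_lin. Qed.

Let DN f : D f -> D (- f).
Proof. by move=> Df; rewrite -scaleN1r; exact: DZ. Qed.

Lemma sublinear_on0 p : sublinear_on p -> p 0 = 0.
Proof.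
move=> [pD pZ]; apply/eqP; rewrite eq_le; apply/andP; split.
  by have := pZ 0 0 (lexx 0) D0; rewrite scale0r mul0r.
by have := pD 0 0 D0 D0; rewrite addr0; lra.
Qed.

(** Source of the lower bounds that make the infima below finite. *)
Lemma sublinear_on_subr p f h : sublinear_on p -> D f -> D h ->
  p h - p (- f) <= p (f + h).
Proof.
move=> [pD pZ] Df Dh.
have := pD _ _ (DD Df Dh) (DN Df).
by rewrite addrAC subrr add0r; lra.
Qed.

(* The infimal convolution of [p] with the cone [K] turns the joint positivity
   [0 <= p h + c] on [K] into the separate bound [q (- h) <= c]. *)
Lemma sublinear_on_infconv p K : sublinear_on p ->
    K 0 -> (forall k, K k -> D k.1 /\ 0 <= p k.1 + k.2) ->
    (forall a k l, 0 <= a -> K k -> K l -> K (a *: k.1 + l.1, a * k.2 + l.2)) ->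
  exists q, [/\ sublinear_on q, forall f, D f -> q f <= p f &
    forall f k, D f -> K k -> q f <= p (f + k.1) + k.2].
Proof.
move=> sp K0 Kp Klin; have [pD pZ] := sp.
pose E f := [set p (f + k.1) + k.2 | k in K].
(* An infimum is meaningful only for a nonempty set bounded below; positivity of [p k.1 + k.2] on
   [K] supplies the bound. *)
have Elb f : D f -> lbound (E f) (- p (- f)).
  move=> Df _ [k Kk <-]; have [Dk pk] := Kp _ Kk.
  by have := sublinear_on_subr sp Df Dk; lra.
have E0 f : E f !=set0 by exists (p (f + 0) + 0), 0.
have qle f k : D f -> K k -> inf (E f) <= p (f + k.1) + k.2.
  move=> Df Kk; apply: ge_inf; last by exists k.
  by exists (- p (- f)); exact: Elb.
have qlep f : D f -> inf (E f) <= p f.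
  by move=> Df; have := qle _ _ Df K0; rewrite !addr0.
exists (fun f => inf (E f)); split => //; split.
- move=> f g Df Dg; rewrite -lerBlDr; apply: lb_le_inf => // _ [k Kk <-].
  rewrite lerBlDl -lerBlDr; apply: lb_le_inf => // _ [l Kl <-].
  rewrite lerBlDl.
  apply: (le_trans (qle _ _ (DD Df Dg) (Klin 1 k l ler01 Kk Kl))) => /=.
  have [[Dk _] [Dl _]] := (Kp _ Kk, Kp _ Kl).
  rewrite scale1r mul1r addrACA.
  by have := pD _ _ (DD Df Dk) (DD Dg Dl); lra.
- move=> a f; rewrite le_eqVlt => /predU1P[<- Df|a0 Df].
    by rewrite scale0r mul0r (le_trans (qlep _ D0)) // (sublinear_on0 sp).
  rewrite mulrC -ler_pdivrMr//; apply: lb_le_inf => // _ [k Kk <-].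
  rewrite ler_pdivrMr//.
  have [Dk _] := Kp _ Kk.
  apply: (le_trans (qle _ _ (DZ a Df) (Klin a k 0 (ltW a0) Kk K0))) => /=.
  rewrite !addr0 -scalerDr.
  by have := pZ a _ (ltW a0) (DD Df Dk); lra.
Qed.

(** Zorn's lemma: the pointwise infimum of a chain is a lower bound of it, finite because each
    member is at least [- p (- f)] at [f]. *)
Lemma sublinear_on_minimal p : sublinear_on p ->
  exists q, [/\ sublinear_on q, forall f, D f -> q f <= p f &
    forall q', sublinear_on q' -> (forall f, D f -> q' f <= q f) ->
      forall f, D f -> q f <= q' f].
Proof.
move=> sp.
pose P q := sublinear_on q /\ forall f, D f -> q f <= p f.
pose T := {q : V -> R | P q}.
(* The order is reversed, so that maximal elements are minimal functionals; it is only a preorder,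
   since values off [D] are not compared. *)
pose rT (s t : T) := `[< forall f, D f -> sval t f <= sval s f >].
have t0 : T by exists p; split.
have [||A tot|[q [sq qp]] qmin] := @ZL_preorder T t0 rT.
- by move=> t; apply/asboolP.
- move=> r s t /asboolP rs /asboolP st; apply/asboolP => f Df.
  exact: le_trans (st _ Df) (rs _ Df).
- have [->|/set0P[a Aa]] := eqVneq A set0; first by exists t0.
  pose E f := [set sval t f | t in A].
  have Elb f : D f -> lbound (E f) (- p (- f)).
    move=> Df _ [[t [st tp]] At <-] /=.
    have := sublinear_on_subr st Df D0.
    by rewrite addr0 (sublinear_on0 st); have := tp _ (DN Df); lra.
  have E0 f : E f !=set0 by exists (sval a f), a.
  have qle t f : A t -> D f -> inf (E f) <= sval t f.
    move=> At Df; apply: ge_inf; last by exists t.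
    by exists (- p (- f)); exact: Elb.
  have sq : sublinear_on (fun f => inf (E f)).
    split=> [f g Df Dg|b f].
      rewrite -lerBlDr; apply: lb_le_inf => // _ [s As <-].
      rewrite lerBlDl -lerBlDr; apply: lb_le_inf => // _ [t At <-].
      rewrite lerBlDl.
      (* Members of a chain are comparable; the smaller of the two bounds the infimum at [f + g]. *)
      have [/asboolP st|/asboolP ts] := tot _ _ As At.
        apply: (le_trans (qle t _ At (DD Df Dg))).
        by have := (svalP t).1.1 _ _ Df Dg; have := st _ Df; lra.
      apply: (le_trans (qle s _ As (DD Df Dg))).
      by have := (svalP s).1.1 _ _ Df Dg; have := ts _ Dg; lra.
    rewrite le_eqVlt => /predU1P[<- Df|b0 Df].
      rewrite scale0r mul0r (le_trans (qle a _ Aa D0)) //.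
      by rewrite (sublinear_on0 (svalP a).1).
    rewrite mulrC -ler_pdivrMr//; apply: lb_le_inf => // _ [s As <-].
    rewrite ler_pdivrMr//; apply: (le_trans (qle s _ As (DZ b Df))).
    by rewrite mulrC; exact: (svalP s).1.2 (ltW b0) Df.
  have qp f : D f -> inf (E f) <= p f.
    by move=> Df; apply: (le_trans (qle a _ Aa Df)); exact: (svalP a).2.
  exists (exist P _ (conj sq qp)) => s As; apply/asboolP => f Df /=.
  exact: qle.
- exists q; split => // q' sq' q'q.
  have q'p f : D f -> q' f <= p f.
    by move=> Df; exact: le_trans (q'q _ Df) (qp _ Df).
  apply/asboolP; apply: (qmin (exist P _ (conj sq' q'p))).
  exact/asboolP.
Qed.

(** Scaling back by [a^-1] reverses the inequality in the definition, which gives true positive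
    homogeneity. *)
Lemma sublinear_on_ge_scale p a f : sublinear_on p -> 0 <= a -> D f ->
  a * p f <= p (a *: f).
Proof.
move=> sp; rewrite le_eqVlt => /predU1P[<- _|a0 Df].
  by rewrite scale0r mul0r (sublinear_on0 sp).
rewrite mulrC -ler_pdivlMr// mulrC -[X in p X <= _]scale1r.
rewrite -(mulVf (lt0r_neq0 a0)) -scalerA.
by apply: sp.2; [rewrite invr_ge0 ltW|exact: DZ].
Qed.

(** Convolving [q] with the ray of the [t (g, - q g)], [0 <= t], gives a sublinear minorant, equal
    to [q] on [D] by minimality; its bound at [t = 1] is the missing inequality
    [q f + q g <= q (f + g)]. *)
Lemma sublinear_on_minimal_linear q : sublinear_on q ->
    (forall q', sublinear_on q' -> (forall f, D f -> q' f <= q f) ->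
      forall f, D f -> q f <= q' f) ->
  linear_on q.
Proof.
move=> sq qmin; have [qD qZ] := sq.
have addq f g : D f -> D g -> q (f + g) = q f + q g.
  move=> Df Dg; apply/eqP; rewrite eq_le qD//=.
  pose K : set (V * R) := [set (t *: g, - (t * q g)) | t in [set t : R | 0 <= t]].
  have K0 : K 0 by exists 0 => /=; rewrite // scale0r mul0r oppr0.
  have Kq k : K k -> D k.1 /\ 0 <= q k.1 + k.2.
    move=> [t /= t0 <-] /=; split; first exact: DZ.
    by rewrite subr_ge0; exact: sublinear_on_ge_scale.
  have [|q' [sq' q'q q'K]] := sublinear_on_infconv sq K0 Kq.
    move=> a _ _ a0 [s /= s0 <-] [t t0 <-] /=; exists (a * s + t) => /=.
      by rewrite addr_ge0// mulr_ge0.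
    by rewrite scalerDl scalerA; congr pair; ring.
  have := qmin _ sq' q'q _ Df.
  have : K (1 *: g, - (1 * q g)) by exists 1 => //=; exact: ler01.
  move/(q'K _ _ Df) => /=; rewrite scale1r mul1r; lra.
have qN f : D f -> q (- f) = - q f.
  move=> Df; apply/eqP; rewrite -addr_eq0 -addq//; last exact: DN.
  by rewrite addNr (sublinear_on0 sq).
have qZp a f : 0 <= a -> D f -> q (a *: f) = a * q f.
  by move=> a0 Df; apply/eqP; rewrite eq_le qZ// sublinear_on_ge_scale.
split=> [//|a f Df]; have [a0|a0] := leP 0 a; first exact: qZp.
rewrite -[a]opprK scaleNr qN; last exact: DZ.
by rewrite qZp ?oppr_ge0 ?ltW// !mulNr.
Qed.

(* Hahn-Banach in sandwich form; for [K] the opposite graph of a linear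
   functional it is the usual dominated extension. *)
Theorem hahn_banach_cone p K : sublinear_on p ->
    K 0 -> (forall k, K k -> D k.1 /\ 0 <= p k.1 + k.2) ->
    (forall a k l, 0 <= a -> K k -> K l -> K (a *: k.1 + l.1, a * k.2 + l.2)) ->
  exists F, [/\ linear_on F, forall f, D f -> F f <= p f &
    forall k, K k -> - F k.1 <= k.2].
Proof.
move=> sp K0 Kp Klin.
have [q [sq qp qK]] := sublinear_on_infconv sp K0 Kp Klin.
have [F [sF Fq Fmin]] := sublinear_on_minimal sq.
have [FD FZ] := sublinear_on_minimal_linear sF Fmin.
exists F; split => [//|f Df|k Kk]; first exact: le_trans (Fq _ Df) (qp _ Df).
have [Dk _] := Kp _ Kk.
(* At [f = - k.1] the convolution bound reduces to [p 0 + k.2 = k.2]. *)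
have := qK _ _ (DN Dk) Kk; rewrite addNr (sublinear_on0 sp) add0r.
have := Fq _ (DN Dk); rewrite -scaleN1r FZ// mulN1r.
lra.
Qed.
End Sublinear.

(** * Integrable and square-integrable functions *)

Section RealIntegral.
Context {d : measure_display} {X : measurableType d} {R : realType}.
Context (mu : {measure set X -> \bar R}) {D : set X} (mD : measurable D).
Implicit Types f g h : X -> R.

(** The codomain is [R^o] so that the functions form an [lmodType], as the Hahn-Banach section
    requires. *)
Definition L1 : set (X -> R^o) := [set f : X -> R^o | mu.-integrable D (EFin \o f)].

Lemma L1_measurable f : L1 f -> measurable_fun D f.
Proof. by move=> /measurable_int/measurable_EFinP. Qed.

Lemma L1_lin a f g : L1 f -> L1 g -> L1 (fun t => a * f t + g t).
Proof.
move=> f1 g1.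
have := integrableD mD (integrableZl mD a f1) g1.
by apply: eq_integrable => // t _ /=; rewrite EFinD EFinM.
Qed.

Lemma L10 : L1 (fun=> 0).
Proof. exact: integrable0. Qed.

Lemma L1_add f g : L1 f -> L1 g -> L1 (fun t => f t + g t).
Proof. by move=> f1 /(L1_lin 1 f1); congr L1; apply/funext => t; rewrite mul1r. Qed.

Lemma L1_scale a f : L1 f -> L1 (fun t => a * f t).
Proof. by move=> f1; have := L1_lin a f1 L10; congr L1; apply/funext => t; rewrite addr0. Qed.

Lemma L1_le f g : measurable_fun D f -> (forall t, D t -> `|f t| <= `|g t|) ->
  L1 g -> L1 f.
Proof.
by move=> mf fg; apply: le_integrable => //; exact/measurable_EFinP.
Qed.

Lemma L1_norm f : L1 f -> L1 (fun t => `|f t|).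
Proof. exact: integrable_norm. Qed.

Lemma L1_bounded_mul (q : X -> R) (M : R) f :
  measurable_fun D q -> (forall t, D t -> `|q t| <= M) ->
  L1 f -> L1 (fun t => q t * f t).
Proof.
move=> mq qM f1; apply: (L1_le _ _ (L1_scale M f1)).
  exact: (measurable_funM mq (L1_measurable f1)).
move=> t Dt; rewrite !normrM ler_wpM2r//; apply: le_trans (ler_norm M).
exact: qM.
Qed.

Lemma L1_max_mul (lo hi : X -> R) (M : R) :
  measurable_fun D lo -> measurable_fun D hi ->
  (forall t, D t -> `|lo t| <= M /\ `|hi t| <= M) ->
  forall f, L1 f -> L1 (fun t => Num.max (lo t * f t) (hi t * f t)).
Proof.
move=> mlo mhi M_ge f f1.
have lo1 := L1_bounded_mul mlo (fun t Dt => (M_ge t Dt).1) f1.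
have hi1 := L1_bounded_mul mhi (fun t Dt => (M_ge t Dt).2) f1.
apply: (L1_le _ _ (L1_add (L1_norm lo1) (L1_norm hi1))).
  exact: (measurable_maxr (L1_measurable lo1) (L1_measurable hi1)).
move=> t _; rewrite [leRHS]ger0_norm ?addr_ge0//.
by rewrite /Num.max; case: ifP => _; rewrite ?lerDl ?lerDr.
Qed.

Lemma Rintegral_lin a f g : L1 f -> L1 g ->
  \int[mu]_(t in D) (a * f t + g t) =
  a * \int[mu]_(t in D) f t + \int[mu]_(t in D) g t.
Proof.
by move=> f1 g1; rewrite RintegralD// ?RintegralZl//; exact: (L1_scale a f1).
Qed.

(* No measurability is assumed: a function that is only almost everywhere equal
   to a measurable one can have arbitrary values on a null set. *)
Lemma ge0_ae_le_integral (f g : X -> \bar R) :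
    (forall t, 0 <= f t)%E -> (forall t, 0 <= g t)%E ->
    {ae mu, forall t, f t = g t} ->
  (\int[mu]_t f t <= \int[mu]_t g t)%E.
Proof.
move=> f0 g0 [N [mN N0 fgN]].
rewrite ge0_integralTE// ge0_integralTE//.
apply: ub_ereal_sup => _ [h /= hf <-].
have mNC : measurable (~` N) by exact: measurableC.
(* Cutting the simple function [h] off on the null set [N] keeps its integral and puts it below
   [g]. *)
pose h' := proj_nnsfun h mNC.
have -> : sintegral mu h = sintegral mu h'.
  rewrite -!integralT_nnsfun; apply: ae_eq_integral => //.
  - exact/measurable_EFinP/measurable_funTS.
  - exact/measurable_EFinP/measurable_funTS.
  exists N; split => // t /= /not_implyP[_ ht]; apply: contrapT => Nt; apply: ht.
  by rewrite /= /mindic indicE mem_set ?mulr1.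
apply: ereal_sup_ubound; exists h' => //= t.
rewrite /mindic indicE; case: (boolP (t \in ~` N)); last by rewrite mulr0.
rewrite inE /= mulr1 => Nt; rewrite (le_trans (hf t))//.
by have [->//|/= fg] := pselect (f t = g t); case: Nt; exact: fgN.
Qed.

(** Lets [S u] be replaced by [S0 u + S 0] in the cost, although the two agree only almost
    everywhere. *)
Lemma ae_eq_RintegralT f g : {ae mu, forall t, f t = g t} ->
  \int[mu]_t f t = \int[mu]_t g t.
Proof.
move=> fg; rewrite /Rintegral; congr fine; rewrite [LHS]integralE [RHS]integralE.
have eqint (u v : X -> \bar R) : (forall t, 0 <= u t)%E -> (forall t, 0 <= v t)%E ->
    {ae mu, forall t, u t = v t} -> (\int[mu]_t u t = \int[mu]_t v t)%E.
  move=> u0 v0 uv; apply/eqP; rewrite eq_le ge0_ae_le_integral// ge0_ae_le_integral//.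
  by apply: filterS uv => t ->.
congr (_ - _)%E; apply: eqint => //; apply: filterS fg => t fgt.
- by rewrite !funeposE fgt.
- by rewrite !funenegE fgt.
Qed.

Definition sq_int f := measurable_fun D f /\ L1 (fun t => f t ^+ 2).

Lemma sq_int_mul f g : sq_int f -> sq_int g -> L1 (fun t => f t * g t).
Proof.
move=> [mf f2] [mg g2]; apply: (L1_le _ _ (L1_add f2 g2)).
  exact: measurable_funM.
move=> t _; rewrite [leRHS]ger0_norm ?addr_ge0 ?sqr_ge0//.
rewrite normrM -(real_normK (num_real (f t))) -(real_normK (num_real (g t))).
by have := sqr_ge0 (`|f t| - `|g t|); have := sqr_ge0 `|f t|; have := sqr_ge0 `|g t|; nra.
Qed.

Lemma sq_int_lin a f g : sq_int f -> sq_int g -> sq_int (fun t => a * f t + g t).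
Proof.
move=> sf sg; have [[mf f2] [mg g2]] := (sf, sg); split.
  apply: measurable_funD => //.
  exact: measurable_funM.
have := L1_lin (a ^+ 2) f2 (L1_lin (2 * a) (sq_int_mul sf sg) g2).
by congr L1; apply/funext => t; ring.
Qed.

Definition ip f g := \int[mu]_(t in D) (f t * g t).

Lemma ipC f g : ip f g = ip g f.
Proof. by apply: eq_Rintegral => t _; rewrite mulrC. Qed.

Lemma ip_linr a f g h : sq_int f -> sq_int g -> sq_int h ->
  ip f (fun t => a * g t + h t) = a * ip f g + ip f h.
Proof.
move=> sf sg sh; rewrite /ip -Rintegral_lin; [|exact: sq_int_mul..].
by apply: eq_Rintegral => t _; ring.
Qed.

Lemma ip_linl a f g h : sq_int f -> sq_int g -> sq_int h ->
  ip (fun t => a * g t + h t) f = a * ip g f + ip h f.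
Proof. by move=> sf sg sh; rewrite ipC ip_linr// ![ip f _]ipC. Qed.

Lemma ip_line s f g : sq_int f -> sq_int g ->
  ip (fun t => s * g t + f t) (fun t => s * g t + f t) =
  s ^+ 2 * ip g g + 2 * s * ip f g + ip f f.
Proof.
move=> sf sg; have sh := sq_int_lin s sg sf.
by rewrite ip_linl// !ip_linr// (ipC g f); ring.
Qed.

End RealIntegral.
Arguments L1 {d X R} mu D.
Arguments sq_int {d X R} mu D f.
Arguments ip {d X R} mu D f g.

(** * Functionals on L^1 *)

Section L1Dual.
Context {d : measure_display} {X : measurableType d} {R : realType}.
Context (mu : {sigma_finite_measure set X -> \bar R}).
Context {D : set X} (mD : measurable D) (muD : (mu D < +oo)%E).
Implicit Types (f g lo hi : X -> R) (F : (X -> R^o) -> R).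
Local Notation L1 := (L1 mu D).

Lemma L1_indic (A : set X) : measurable A -> L1 \1_A.
Proof.
move=> mA; apply: measurable_bounded_integrable => //.
exists 1; split=> // x x1 t _ /=; rewrite indicE ger0_norm//.
by apply: le_trans (ltW x1); case: (_ \in _).
Qed.

Lemma linear_on_sum F (I : Type) (r : seq I) (h : I -> X -> R) :
    linear_on L1 F -> (forall i, L1 (h i)) ->
  L1 (fun t => \sum_(i <- r) h i t) /\
  F (fun t => \sum_(i <- r) h i t) = \sum_(i <- r) F (h i).
Proof.
move=> [FD FZ] h1; elim: r => [|i r [IH1 IH2]].
  have -> : (fun t => \sum_(i <- [::]) h i t) = fun=> 0.
    by apply/funext => t; rewrite big_nil.
  split; first exact: L10.
  rewrite big_nil; apply: etrans (mul0r (F (fun=> 0))).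
  rewrite -FZ; last exact: L10.
  by congr F; apply/funext => t; rewrite [RHS]mul0r.
have -> : (fun t => \sum_(j <- i :: r) h j t) =
    fun t => h i t + \sum_(j <- r) h j t.
  by apply/funext => t; rewrite big_cons.
split; first exact: L1_add.
by rewrite big_cons -IH2 -FD.
Qed.

Lemma linear_on_Rintegral : linear_on L1 (fun f => \int[mu]_(t in D) f t).
Proof.
split=> [f g f1 g1|a f f1]; first by rewrite -RintegralD.
by rewrite -RintegralZl.
Qed.

Lemma linear_on_sub F G : linear_on L1 F -> linear_on L1 G ->
  linear_on L1 (fun f => F f - G f).
Proof.
move=> [FD FZ] [GD GZ]; split => [f g f1 g1|a f f1].
  by rewrite FD// GD//; ring.
by rewrite FZ// GZ//; ring.
Qed.

(** Testing with the set where [g < f] gives a positive function with nonpositive integral, so that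
    set is null. *)
Lemma L1_ae_le f g : L1 f -> L1 g ->
    (forall A, measurable A -> A `<=` D ->
      \int[mu]_(t in A) f t <= \int[mu]_(t in A) g t) ->
  {ae mu, forall t, D t -> f t <= g t}.
Proof.
move=> f1 g1 fg.
have [mf mg] := (L1_measurable f1, L1_measurable g1).
pose A := D `&` [set t | g t < f t].
have mA : measurable A.
  by have := measurable_fun_ltr mg mf mD (Y := [set true]); exact.
have AD : A `<=` D by move=> t [].
have fgA : mu.-integrable A (EFin \o (f \- g)).
  apply: (integrableS mD mA AD).
  have := L1_add mD f1 (L1_scale mD (-1) g1).
  by congr (mu.-integrable D _); apply/funext => t /=; rewrite mulN1r.
have int0 : (\int[mu]_(t in A) `|(f t - g t)%:E| = 0)%E.
  under eq_integral => t.
    rewrite inE => -[_ /= gf]; rewrite ger0_norm ?subr_ge0 ?ltW//.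
    over.
  have : \int[mu]_(t in A) (f t - g t) <= 0.
    rewrite RintegralB//; first by rewrite subr_le0 fg.
    - exact: (integrableS mD mA AD).
    - exact: (integrableS mD mA AD).
  rewrite /Rintegral => le0.
  have fin := integrable_fin_num mA fgA.
  rewrite -(fineK fin); congr EFin; apply/eqP; rewrite eq_le le0 /=.
  apply: fine_ge0; apply: integral_ge0 => t [_ /= gf].
  by rewrite lee_fin subr_ge0 ltW.
have mfg : measurable_fun A (fun t => (f t - g t)%:E).
  exact: measurable_int fgA.
have [N [mN N0 AN]] := (ae_eq_integral_abs mu mA mfg).1 int0.
exists N; split => // t /= nle; apply: AN => /= tA; apply: nle => Dt.
rewrite leNgt; apply/negP => gf.
have : A t by [].
by move/tA => -[] /eqP; rewrite subr_eq0 => /eqP fgt; move: gf; rewrite fgt ltxx.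
Qed.

Section Density.
Variables (F : (X -> R^o) -> R) (M : R).
Hypotheses (F_lin : linear_on L1 F)
  (F_le : forall f, L1 f -> F f <= M * \int[mu]_(t in D) `|f t|).

Lemma L1_functional_norm_le f : L1 f -> `|F f| <= M * \int[mu]_(t in D) `|f t|.
Proof.
move=> f1; rewrite ler_norml F_le// andbT lerNl -mulN1r -F_lin.2//.
apply: (le_trans (F_le (L1_scale mD (-1) f1))); rewrite le_eqVlt; apply/orP; left.
apply/eqP; congr (_ * _); apply: eq_Rintegral => t _.
by rewrite mulN1r normrN.
Qed.

(** Simple functions are finite combinations of indicators and are dense in L^1, where the norm
    bound makes [F] continuous. *)
Lemma L1_functional_eq0 : (forall A, measurable A -> F \1_A = 0) ->
  forall f, L1 f -> F f = 0.
Proof.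
move=> F1 f f1.
have Fs (g : {sfun X >-> R}) : F g = 0.
  have [s gE] : exists s : seq R, (g : X -> R) =
      fun t => \sum_(y <- s) (fun u => y * \1_(g @^-1` [set y]) u) t.
    by eexists; apply/funext => t; rewrite fimfunE fsbig_finite.
  have mg y : measurable (g @^-1` [set y]) by exact: measurable_sfunP.
  rewrite gE (linear_on_sum _ F_lin _).2.
    rewrite big1// => y _.
    by rewrite (F_lin.2 y \1_(g @^-1` [set y]))/= ?F1 ?mulr0//; exact: L1_indic.
  by move=> y; apply: L1_scale => //; exact: L1_indic.
have [g_ [g1 _ gf]] := approximation_sfun_integrable mD f1.
have fg1 n : L1 (fun t => f t - g_ n t).
  have := L1_add mD f1 (L1_scale mD (-1) (g1 n)).
  by congr (L1 _); apply/funext => t /=; rewrite mulN1r.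
have FE n : `|F f| <= M * \int[mu]_(t in D) `|f t - g_ n t|.
  have -> : F f = F (fun t => f t - g_ n t).
    have := F_lin.1 _ _ (fg1 n) (g1 n); rewrite Fs addr0 => <-.
    by congr F; apply/funext => t; rewrite [RHS]subrK.
  exact: L1_functional_norm_le.
apply/eqP; rewrite -normr_le0.
have cv : (M * \int[mu]_(t in D) `|f t - g_ n t|) @[n --> \oo] --> M * 0.
  by apply: cvgMl_tmp; exact: (fine_cvg gf).
by rewrite mulr0 in cv; apply: (cvgr_to_ge cv); exact: nearW.
Qed.
End Density.

Section Representation.
Variables (F : (X -> R^o) -> R) (M : R).
Hypotheses (F_lin : linear_on L1 F)
  (F_le : forall f, L1 f -> F f <= M * \int[mu]_(t in D) `|f t|).

Let nu (A : set X) : \bar R := (F \1_A)%:E.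

Let Fnorm := L1_functional_norm_le F_lin F_le.

(** This is how [F], defined on functions rather than classes, is seen to ignore null sets and
    values outside [D]. *)
Let F0 f : L1 f -> \int[mu]_(t in D) `|f t| = 0 -> F f = 0.
Proof.
move=> f1 f0; apply/eqP; rewrite -normr_le0.
by have := Fnorm f1; rewrite f0 mulr0.
Qed.

Let nu0 : nu set0 = 0.
Proof.
rewrite /nu F0//; first exact: L1_indic.
by under eq_Rintegral do rewrite indic0 normr0; rewrite Rintegral_cst// mul0r.
Qed.

Let nu_fin (A : set X) : measurable A -> nu A \is a fin_num.
Proof. by []. Qed.

(** At most one term is nonzero. In [nu_sigma] this removes the absolute value from the
    remainder. *)
Lemma sum_indic_trivIset_le (B : (set X)^nat) n t : trivIset setT B ->
  \sum_(i < n) \1_(B i) t <= \1_(\bigcup_i B i) t :> R.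
Proof.
move=> tB; have [[i Bi]|nB] := pselect (exists i : 'I_n, B i t).
  rewrite (bigD1 i)//= big1 => [|j ji].
    by rewrite addr0 !indicE !mem_set//; exists i.
  rewrite indicE memNset// => Bj; move/eqP: ji; apply; apply/val_inj.
  by apply: (tB j i) => //; exists t.
rewrite big1 => [|i _]; first by rewrite indicE; case: (_ \in _).
by rewrite indicE memNset// => Bi; apply: nB; exists i.
Qed.

(** The remainder of the series is [F] at the indicator of the tail, hence at most [M] times the
    measure of the tail within [D], which tends to 0 by countable additivity of [mu]. *)
Let nu_sigma : semi_sigma_additive nu.
Proof.
move=> B mB tB mUB.
have B1 i : L1 \1_(B i) by exact: L1_indic.
have U1 : L1 \1_(\bigcup_i B i) by exact: L1_indic.
have intE (A : set X) : measurable A -> \int[mu]_(t in D) \1_A t = fine (mu (A `&` D)).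
  by move=> mA; rewrite /Rintegral integral_indic.
have finI (A : set X) : measurable A -> mu (A `&` D) \is a fin_num.
  move=> mA; rewrite ge0_fin_numE//; apply: le_lt_trans muD.
  by apply: le_measure; rewrite ?inE//; exact: measurableI.
pose r n := M * (fine (mu ((\bigcup_i B i) `&` D)) - \sum_(i < n) fine (mu (B i `&` D))).
have r0 : r n @[n --> \oo] --> 0.
  have := @measure_semi_sigma_additive _ _ _ (mrestr mu mD) B mB tB mUB.
  rewrite /mrestr -[X in _ --> X]fineK ?finI// => /fine_cvg cv.
  have -> : nbhs (0 : R) = nbhs (M * (fine (mu ((\bigcup_i B i) `&` D)) -
      fine (mu ((\bigcup_i B i) `&` D)))) by rewrite subrr mulr0.
  apply: cvgMl_tmp; apply: cvgB; first exact: cvg_cst.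
  apply: cvg_trans cv; apply: near_eq_cvg; apply: nearW => n.
  by rewrite /= big_mkord -sum_fine// => i _; exact: finI.
have Fr n : `|F \1_(\bigcup_i B i) - \sum_(i < n) F \1_(B i)| <= r n.
  have [S1 SF] := linear_on_sum (index_enum 'I_n) F_lin (fun i : 'I_n => B1 i).
  have [_ SI] := linear_on_sum (index_enum 'I_n) linear_on_Rintegral (fun i : 'I_n => B1 i).
  have /= sub1 := L1_lin mD (-1) S1 U1.
  have -> : F \1_(\bigcup_i B i) - \sum_(i < n) F \1_(B i) =
      F (fun t => -1 * (\sum_(i < n) \1_(B i) t) + \1_(\bigcup_i B i) t).
    rewrite -SF addrC -[- F _]mulN1r -F_lin.2// -F_lin.1//.
    exact: (L1_scale mD (-1) S1).
  apply: (le_trans (Fnorm sub1)); rewrite le_eqVlt; apply/orP; left; apply/eqP.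
  rewrite /r; congr (_ * _).
  under eq_Rintegral => t _.
    rewrite ger0_norm; last by rewrite mulN1r addrC subr_ge0 sum_indic_trivIset_le.
    over.
  rewrite (Rintegral_lin mD (-1) S1 U1) SI addrC mulN1r intE//.
  by congr (_ - _); apply: eq_bigr => i _; rewrite intE.
rewrite (_ : (fun n => _) = EFin \o (fun n => \sum_(0 <= i < n) F \1_(B i))); last first.
  by apply/funext => n; rewrite /= sumEFin.
apply/cvg_EFin; first exact: nearW.
apply/cvgrPdist_le => /= e e0.
have /cvgr_le/(_ e e0) := r0; apply: filterS => n; apply: le_trans.
by rewrite big_mkord.
Qed.

Let chnu : {charge set X -> \bar R} :=
  HB.pack nu (isCharge.Build _ _ _ nu nu0 nu_fin nu_sigma).

Lemma L1_functional_density : exists q, L1 q /\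
  forall A, measurable A -> F \1_A = \int[mu]_(t in A `&` D) q t.
Proof.
have dom : chnu `<< mu.
  apply/null_content_dominatesP => A mA A0; rewrite /= /nu F0//.
    exact: L1_indic.
  under eq_Rintegral do rewrite ger0_norm//.
  rewrite /Rintegral integral_indic//; apply: (congr1 fine (y := 0%E)).
  apply/eqP; rewrite -measure_le0 -A0; apply: le_measure; rewrite ?inE//.
  exact: measurableI.
have RNint := Radon_Nikodym_integrable dom.
exists (fine \o Radon_Nikodym chnu mu); split.
  apply: (integrableS measurableT mD) => //.
  apply: eq_integrable RNint => // t _ /=.
  by rewrite fineK// Radon_Nikodym_fin_num.
move=> A mA; have mAD := measurableI A D mA mD.
(* The two indicators agree on [D], so [F0] applies to their difference. *)
have -> : F \1_A = F \1_(A `&` D).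
  apply/eqP; rewrite -subr_eq0 addrC -mulN1r -F_lin.2; last exact: L1_indic.
  have I1 := L1_scale mD (-1) (L1_indic mAD).
  rewrite -(F_lin.1 _ _ I1 (L1_indic mA)) F0//.
    exact: (L1_lin mD (-1) (L1_indic mAD) (L1_indic mA)).
  under eq_Rintegral => t.
    rewrite inE => Dt; rewrite [X in `|X|](_ : _ = 0) ?normr0; first over.
    rewrite [LHS](_ : _ = -1 * \1_(A `&` D) t + \1_A t)// mulN1r addrC !indicE.
    by rewrite in_setI (mem_set Dt) andbT subrr.
  by rewrite Rintegral_cst// mul0r.
have := Radon_Nikodym_integral dom mAD.
rewrite /= /nu /Rintegral => /(congr1 fine) /= ->; congr fine.
by apply: eq_integral => t _ /=; rewrite fineK// Radon_Nikodym_fin_num.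
Qed.
End Representation.

(* [lo] and [hi] are the extreme points of the subdifferential of the sublinear
   functional [f |-> \int max (lo f) (hi f)]. *)
Lemma L1_functional_between F lo hi (M : R) :
    measurable_fun D lo -> measurable_fun D hi ->
    (forall t, D t -> [/\ lo t <= hi t, `|lo t| <= M & `|hi t| <= M]) ->
    linear_on L1 F ->
    (forall f, L1 f -> F f <= \int[mu]_(t in D) Num.max (lo t * f t) (hi t * f t)) ->
  exists q : X -> R, [/\ measurable_fun D q, forall t, D t -> lo t <= q t <= hi t &
    forall f, L1 f -> F f = \int[mu]_(t in D) (q t * f t)].
Proof.
move=> mlo mhi lohi F_lin F_le.
have lohiM t : D t -> `|lo t| <= M /\ `|hi t| <= M by case/lohi.
have max1 f : L1 f -> L1 (fun t => Num.max (lo t * f t) (hi t * f t)).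
  exact: (L1_max_mul mD mlo mhi lohiM).
have F_norm f : L1 f -> F f <= M * \int[mu]_(t in D) `|f t|.
  move=> f1; apply: (le_trans (F_le _ f1)).
  rewrite -RintegralZl//; last exact: (L1_norm f1).
  apply: le_Rintegral => //; first exact: max1.
    exact: (L1_scale mD M (L1_norm f1)).
  move=> t Dt; have [_ loM hiM] := lohi _ Dt.
  rewrite ge_max; apply/andP; split; apply: (le_trans (ler_norm _));
    by rewrite normrM ler_wpM2r.
have [q [q1 qE]] := L1_functional_density F_lin F_norm.
have cst1 : L1 (fun=> 1).
  by have := L1_indic mD; apply: eq_integrable => // t Dt; rewrite /= indicE Dt.
have lo1 : L1 lo.
  have := L1_bounded_mul mD mlo (fun t Dt => (lohiM t Dt).1) cst1.
  by congr L1; apply/funext => t; rewrite mulr1.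
have hi1 : L1 hi.
  have := L1_bounded_mul mD mhi (fun t Dt => (lohiM t Dt).2) cst1.
  by congr L1; apply/funext => t; rewrite mulr1.
have indic_int A f : \int[mu]_(t in D) (f t * \1_A t) = \int[mu]_(t in A `&` D) f t.
  rewrite Rintegral_mkcondl; apply: eq_Rintegral => t _; rewrite patchE indicE.
  by case: (_ \in _); rewrite ?mulr1 ?mulr0.
have qhi : {ae mu, forall t, D t -> q t <= hi t}.
  apply: L1_ae_le => // A mA /setIidl AD; rewrite -[in leLHS]AD -[in leRHS]AD -qE// -indic_int.
  apply: (le_trans (F_le _ (L1_indic mA))); rewrite le_eqVlt; apply/orP; left.
  apply/eqP; apply: eq_Rintegral => t; rewrite inE => Dt.
  by rewrite max_r// ler_wpM2r//; have [] := lohi _ Dt.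
have qlo : {ae mu, forall t, D t -> lo t <= q t}.
  apply: L1_ae_le => // A mA /setIidl AD; rewrite -[in leLHS]AD -[in leRHS]AD -qE// -indic_int.
  have I1 := L1_indic mA.
  (* At [- \1_A] the maximum is [- lo] on [A], so the upper bound on [F] becomes a lower bound. *)
  have := F_le _ (L1_scale mD (-1) I1).
  rewrite (F_lin.2 (-1) _ I1) mulN1r lerNl; apply: le_trans.
  rewrite -[leRHS]mulN1r -RintegralZl//; last exact: (max1 _ (L1_scale mD (-1) I1)).
  rewrite le_eqVlt; apply/orP; left.
  apply/eqP; apply: eq_Rintegral => t; rewrite inE => Dt.
  rewrite max_l ?mulN1r ?mulrN ?opprK//.
  by rewrite lerN2 ler_wpM2r//; have [] := lohi _ Dt.
(* The density obeys the bounds only almost everywhere; clamping enforces them at every point of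
   [D], so that [q'] is bounded there by [M]. *)
pose q' t := Num.max (lo t) (Num.min (q t) (hi t)).
have mq := L1_measurable q1.
have mq' : measurable_fun D q'.
  by apply: measurable_maxr => //; apply: measurable_minr.
have q'b t : D t -> lo t <= q' t <= hi t.
  by move=> Dt; have [lh _ _] := lohi _ Dt; rewrite le_max lexx ge_max lh ge_min lexx orbT.
have q'M t : D t -> `|q' t| <= M.
  move=> Dt; have /andP[lq qh] := q'b _ Dt; have [_] := lohi _ Dt.
  by rewrite !ler_norml => /andP[l1 _] /andP[_ h2]; rewrite (le_trans l1)//= (le_trans qh).
exists q'; split => // f f1.
(* So far [F] is represented on indicators only. The error [G] is L^1-bounded and vanishes on
   indicators, hence on all of L^1. *)
pose G (f : X -> R^o) := F f - \int[mu]_(t in D) (q' t * f t).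
have bndq g : L1 g -> L1 (fun t => q' t * g t).
  exact: (L1_bounded_mul mD mq' q'M).
have G_lin : linear_on L1 G.
  apply: linear_on_sub => //; split => [g h g1 h1|a g g1].
    rewrite -RintegralD; [|by []|exact: bndq|exact: bndq].
    by apply: eq_Rintegral => t _; rewrite mulrDr.
  rewrite -RintegralZl; [|by []|exact: bndq].
  by apply: eq_Rintegral => t _; rewrite mulrCA.
have G_norm g : L1 g -> G g <= (M + M) * \int[mu]_(t in D) `|g t|.
  move=> g1; rewrite mulrDl lerD ?F_norm//.
  rewrite (le_trans (ler_norm _))// normrN (le_trans (le_normr_Rintegral mD (bndq _ g1)))//.
  rewrite -RintegralZl//; last exact: (L1_norm g1).
  apply: le_Rintegral => //; first exact: (L1_norm (bndq _ g1)).
    exact: (L1_scale mD M (L1_norm g1)).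
  by move=> t Dt; rewrite normrM ler_wpM2r// q'M.
apply/eqP; rewrite -subr_eq0; apply/eqP.
apply: (L1_functional_eq0 G_lin G_norm _ f1) => A mA.
rewrite /G qE// indic_int; apply/eqP; rewrite subr_eq0; apply/eqP.
have mAD := measurableI A D mA mD.
rewrite /Rintegral; congr fine; apply: ae_eq_integral => //.
- by apply/measurable_EFinP; apply: measurable_funS mq => // t [].
- by apply/measurable_EFinP; apply: measurable_funS mq' => // t [].
apply: filterS2 qlo qhi => t lq qh [_ Dt].
by rewrite /q' min_l ?qh// max_r ?lq.
Qed.

(** Here [K] is a linear space, not merely a cone: the sandwich bound at [k] and at [- k] gives an
    equality. *)
Theorem L1_multiplier (lo hi : X -> R) (M : R) (K : set ((X -> R^o) * R)) :
    measurable_fun D lo -> measurable_fun D hi ->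
    (forall t, D t -> [/\ lo t <= hi t, `|lo t| <= M & `|hi t| <= M]) ->
    K !=set0 ->
    (forall a k l, K k -> K l -> K (a *: k.1 + l.1, a * k.2 + l.2)) ->
    (forall k, K k -> L1 k.1 /\
      0 <= \int[mu]_(t in D) Num.max (lo t * k.1 t) (hi t * k.1 t) + k.2) ->
  exists q : X -> R, [/\ measurable_fun D q, forall t, D t -> lo t <= q t <= hi t &
    forall k, K k -> \int[mu]_(t in D) (q t * k.1 t) + k.2 = 0].
Proof.
move=> mlo mhi lohi [k0 Kk0] Klin Kpos.
have lohiM t : D t -> `|lo t| <= M /\ `|hi t| <= M by case/lohi.
have max1 f : L1 f -> L1 (fun t => Num.max (lo t * f t) (hi t * f t)).
  exact: (L1_max_mul mD mlo mhi lohiM).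
pose p (f : X -> R^o) := \int[mu]_(t in D) Num.max (lo t * f t) (hi t * f t).
have sp : sublinear_on L1 p.
  split=> [f g f1 g1|a f a0 f1].
    rewrite /p -RintegralD; [|by []|exact: max1|exact: max1].
    have fg1 : L1 (f + g) by exact: L1_add.
    apply: le_Rintegral => //; first exact: (max1 _ fg1).
      exact: (L1_add mD (max1 _ f1) (max1 _ g1)).
    move=> t _; rewrite ge_max; apply/andP.
    by rewrite !mulrDr !lerD ?le_max ?lexx ?orbT.
  rewrite /p -RintegralZl; [|by []|exact: max1].
  rewrite le_eqVlt; apply/orP; left; apply/eqP; apply: eq_Rintegral => t _.
  by rewrite maxr_pMr// !(mulrCA a).
have K0 : K 0.
  have := Klin (-1) _ _ Kk0 Kk0.
  by rewrite scaleN1r addNr mulN1r addNr.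
have L1lin a (f g : X -> R^o) : L1 f -> L1 g -> L1 (a *: f + g) by exact: L1_lin.
have [F [F_lin Fp FK]] := hahn_banach_cone (L10 mu : L1 0) L1lin sp K0
  (fun k Kk => Kpos k Kk) (fun a k l _ => @Klin a k l).
have [q [mq qb qE]] := L1_functional_between mlo mhi lohi F_lin Fp.
exists q; split => // k Kk; rewrite -qE; last exact: (Kpos k Kk).1.
have := FK _ Kk; have := FK _ (Klin (-1) _ _ Kk K0) => /=.
have [k1 _] := Kpos _ Kk.
by rewrite !addr0 F_lin.2//; lra.
Qed.

End L1Dual.

(** * Directional derivative of the L^1 norm *)

(** With [x = 1/s] the left side is the difference quotient of [b |.|] at [p] in direction [l]. It
    equals its limit as soon as [x |p|] dominates [|l|], since [x p + l] then cannot have the sign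
    opposite to [p]; at [p = 0] it is [b |l|] for every [x]. *)
Lemma abs_slopeE {R : realType} (b p l x : R) : 0 <= b -> 0 <= x ->
    p = 0 \/ `|l| <= x * `|p| ->
  b * (`|x * p + l| - x * `|p|) =
  Num.max ((if 0 < p then b else - b) * l) ((if p < 0 then - b else b) * l).
Proof.
move=> b0 x0 [->|lx].
  rewrite mulr0 add0r normr0 mulr0 subr0 ltxx.
  have [l0|l0] := leP 0 l.
    by rewrite ger0_norm// max_r//; nra.
  by rewrite ltr0_norm// max_l//; nra.
have [p0|p0|p0] := ltgtP 0 p.
- rewrite maxxx; rewrite (gtr0_norm p0) in lx *.
  by move: lx; rewrite ler_norml => /andP[lx _]; rewrite ger0_norm; [ring|lra].
- rewrite maxxx; rewrite (ltr0_norm p0) in lx *.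
  by move: lx; rewrite ler_norml => /andP[_ lx]; rewrite ler0_norm; [ring|lra].
- move: lx; rewrite -p0 normr0 mulr0 normr_le0 => /eqP ->.
  by rewrite !mulr0 addr0 normr0 subrr maxxx mulr0.
Qed.

Section AbsDirectionalDerivative.
Context {d : measure_display} {X : measurableType d} {R : realType}.
Context (mu : {measure set X -> \bar R}) {D : set X} (mD : measurable D).
Implicit Types p l r : X -> R.
Local Notation L1 := (L1 mu D).

(** Dominated convergence: each pointwise sequence is eventually constant, and [b |l|] dominates by
    the reverse triangle inequality. *)
Lemma cvg_abs_slope (b : R) p l : 0 <= b -> L1 p -> L1 l ->
  b * (\int[mu]_(t in D) (`|n.+1%:R * p t + l t| - n.+1%:R * `|p t|)) @[n --> \oo] -->
  \int[mu]_(t in D) Num.max ((if 0 < p t then b else - b) * l t)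
                            ((if p t < 0 then - b else b) * l t).
Proof.
move=> b0 p1 l1.
pose f n t := b * (`|n.+1%:R * p t + l t| - n.+1%:R * `|p t|).
have f1' n : L1 (fun t => `|n.+1%:R * p t + l t| - n.+1%:R * `|p t|).
  have := L1_lin mD (- n.+1%:R) (L1_norm p1) (L1_norm (L1_lin mD n.+1%:R p1 l1)).
  by congr (L1 _); apply/funext => t; rewrite mulNr addrC.
have f1 n : L1 (f n) := L1_scale mD b (f1' n).
pose g t := Num.max ((if 0 < p t then b else - b) * l t)
                    ((if p t < 0 then - b else b) * l t).
have fg t : f n t @[n --> \oo] --> g t.
  apply: cvg_near_cst; near=> n; apply: abs_slopeE => //.
  have [p0|p0] := eqVneq (p t) 0; [by left|right].
  rewrite -ler_pdivrMr ?normr_gt0//.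
  apply: (@le_trans _ _ n%:R); last by rewrite ler_nat.
  by near: n; exact: nbhs_infty_ger.
have fle n t : `|f n t| <= b * `|l t|.
  rewrite normrM ger0_norm// ler_wpM2l//.
  have -> : n.+1%:R * `|p t| = `|n.+1%:R * p t| by rewrite normrM ger0_norm.
  by rewrite (le_trans (ler_dist_dist _ _))// addrC addKr.
have [|||||_ _ cv] := @dominated_convergence _ _ _ mu D mD
    (fun n t => (f n t)%:E) (EFin \o g) (fun t => (b * `|l t|)%:E).
- by move=> n; exact/measurable_EFinP/(L1_measurable (f1 n)).
- apply/measurable_EFinP.
  apply: (measurable_fun_cvg (fun n => L1_measurable (f1 n))) => t _; exact: fg.
- by apply: aeW => t _; apply/fine_cvgP; split; [exact: nearW|exact: fg].
- exact: (L1_scale mD b (L1_norm l1)).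
- by apply: aeW => t n _; rewrite lee_fin.
have g1 : L1 g.
  apply: (L1_le mD _ _ (L1_scale mD b l1)).
    apply: (measurable_fun_cvg (fun n => L1_measurable (f1 n))) => t _; exact: fg.
  move=> t _; rewrite normrM (ger0_norm b0).
  apply: (cvgr_to_le (cvg_norm (fg t))); exact: nearW.
rewrite -[X in _ --> X]fineK ?integrable_fin_num// in cv.
move/fine_cvg: cv; apply: cvg_trans; apply: near_eq_cvg; apply: nearW => n /=.
by rewrite -RintegralZl; [by []|by []|exact: f1'].
Unshelve. all: by end_near.
Qed.

(** Along [u + s v] the product of the components is [p + s l + s^2 r], and the quadratic cost
    changes by [s a + s^2 c]. Divided by [s = 1/(n+1)], the second order terms contribute at most
    [s (c + b ir)], which tends to 0. *)
Lemma abs_integral_stationary (a c b s0 : R) p l r :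
    0 <= b -> 0 < s0 -> L1 p -> L1 l -> L1 r ->
    (forall s, 0 < s < s0 -> 0 <= s * a + s ^+ 2 * c +
      b * (\int[mu]_(t in D) `|p t + s * l t + s ^+ 2 * r t| -
           \int[mu]_(t in D) `|p t|)) ->
  0 <= \int[mu]_(t in D) Num.max ((if 0 < p t then b else - b) * l t)
                            ((if p t < 0 then - b else b) * l t) + a.
Proof.
move=> b0 s00 p1 l1 r1 s_ge.
pose ir := \int[mu]_(t in D) `|r t|.
have cvh : (n.+1%:R^-1 * (c + b * ir)) @[n --> \oo] --> (0 : R).
  rewrite -(mul0r (c + b * ir)); apply: cvgMr_tmp; exact: cvg_harmonic.
have cv : (b * (\int[mu]_(t in D) (`|n.+1%:R * p t + l t| - n.+1%:R * `|p t|)) + a +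
    n.+1%:R^-1 * (c + b * ir)) @[n --> \oo] -->
    \int[mu]_(t in D) Num.max ((if 0 < p t then b else - b) * l t)
                            ((if p t < 0 then - b else b) * l t) + a.
  rewrite -[X in _ --> X]addr0; apply: cvgD cvh; apply: cvgD; last exact: cvg_cst.
  exact: cvg_abs_slope.
apply: (cvgr_to_ge cv); near=> n.
have ss0 : n.+1%:R^-1 < s0.
  by near: n; apply: (cvgr_lt (0 : R) _ _ s00); exact: cvg_harmonic.
have sgt0 : 0 < n.+1%:R^-1 :> R by rewrite invr_gt0.
set s : R := n.+1%:R^-1 in ss0 sgt0 *.
have := s_ge s; rewrite sgt0 ss0 => /(_ isT).
have q1 : L1 (fun t => `|p t + s * l t + s ^+ 2 * r t|).
  apply: L1_norm; have := L1_lin mD (s ^+ 2) r1 (L1_lin mD s l1 p1).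
  by congr (L1 _); apply/funext => t; ring.
have slope1 : L1 (fun t => `|n.+1%:R * p t + l t| - n.+1%:R * `|p t|).
  have := L1_lin mD (- n.+1%:R) (L1_norm p1) (L1_norm (L1_lin mD n.+1%:R p1 l1)).
  by congr (L1 _); apply/funext => t; rewrite mulNr addrC.
(* The triangle inequality splits off [s^2 |r|] and leaves [s] times the slope. *)
have /(le_Rintegral mD q1 (L1_lin mD (s ^+ 2) (L1_norm r1)
    (L1_lin mD s slope1 (L1_norm p1)))) : forall t, D t ->
    `|p t + s * l t + s ^+ 2 * r t| <= s ^+ 2 * `|r t| +
      (s * (`|n.+1%:R * p t + l t| - n.+1%:R * `|p t|) + `|p t|).
  move=> t _; rewrite (le_trans (ler_normD _ _))// normrM (ger0_norm (sqr_ge0 s)).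
  rewrite addrC lerD2l mulrBr mulrA mulVf ?pnatr_eq0// mul1r subrK.
  rewrite -[X in X * `|_|](ger0_norm (ltW sgt0)) -normrM mulrDr mulrA.
  by rewrite mulVf ?pnatr_eq0// mul1r.
rewrite (Rintegral_lin mD _ (L1_norm r1) (L1_lin mD s slope1 (L1_norm p1))).
rewrite (Rintegral_lin mD s slope1 (L1_norm p1)) -/ir.
set I1 := \int[mu]_(t in D) `|p t + _ + _|; set I2 := \int[mu]_(t in D) `|p t|.
set I3 := \int[mu]_(t in D) (_ - _).
move=> le1 ge0.
have : 0 <= s * (b * I3 + a + s * (c + b * ir)).
  have -> : s * (b * I3 + a + s * (c + b * ir)) =
    s * a + s ^+ 2 * c + b * (s ^+ 2 * ir + (s * I3 + I2) - I2) by ring.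
  by apply: (le_trans ge0); rewrite lerD2l ler_wpM2l// lerD2r.
by rewrite pmulr_rge0.
Unshelve. all: by end_near.
Qed.
End AbsDirectionalDerivative.

(** * The reduced cost *)

Section ReducedCost.
Context {R : realType} {d : measure_display} {X : measurableType d}.
Context (muX : {measure set X -> \bar R}) (T : R) (S S0 : @ctrl R -> X -> R).
Context (yd : X -> R) (alpha beta eps : R).
Implicit Types u v w du dv : @ctrl R.
Local Notation mu := (@lebesgue_measure R).
Local Notation E := (tI T).

Hypotheses (yd_L2 : L2X muX yd)
  (S0_L2 : forall u, L2c T u -> L2X muX (S0 u))
  (S0_lin : forall (a : R) u v, L2c T u -> L2c T v ->
     {ae muX, forall x, S0 (ctrl_add (ctrl_scale a u) v) x = a * S0 u x + S0 v x})
  (Sz_L2 : L2X muX (S ctrl_zero))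
  (S_affine : forall u, L2c T u ->
     {ae muX, forall x, S u x = S0 u x + S ctrl_zero x}).

Let mE : @measurable _ (measurableTypeR R) E.
Proof. exact: measurable_itv. Qed.

Let L2c_sq u : L2c T u -> sq_int mu E u.1 /\ sq_int mu E u.2.
Proof. by []. Qed.

Lemma L2c_lin a u v : L2c T u -> L2c T v -> L2c T (ctrl_add (ctrl_scale a u) v).
Proof.
move=> /L2c_sq[u1 u2] /L2c_sq[v1 v2].
by split; [exact: (sq_int_lin mE a u1 v1)|exact: (sq_int_lin mE a u2 v2)].
Qed.

Lemma ipc_linr a u v w : L2c T u -> L2c T v -> L2c T w ->
  ipc T u (ctrl_add (ctrl_scale a v) w) = a * ipc T u v + ipc T u w.
Proof.
move=> /L2c_sq[u1 u2] /L2c_sq[v1 v2] /L2c_sq[w1 w2].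
have := ip_linr mE a u1 v1 w1; have := ip_linr mE a u2 v2 w2.
rewrite /ip /ipc /ipT /= => -> ->; ring.
Qed.

Lemma normc2_line s u v : L2c T u -> L2c T v ->
  normc2 T (ctrl_add (ctrl_scale s v) u) =
  s ^+ 2 * normc2 T v + 2 * s * ipc T u v + normc2 T u.
Proof.
move=> /L2c_sq[u1 u2] /L2c_sq[v1 v2].
have := ip_line mE s u1 v1; have := ip_line mE s u2 v2.
rewrite /ip /normc2 /ipc /ipT /= => -> ->; ring.
Qed.

Lemma normc2_sub_line s u v : L2c T v ->
  normc2 T (ctrl_sub (ctrl_add (ctrl_scale s v) u) u) = s ^+ 2 * normc2 T v.
Proof.
move=> /L2c_sq[v1 v2]; rewrite /normc2 /ipc /ipT /ctrl_sub /= mulrDr.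
have [v11 v22] := (sq_int_mul mE v1 v1, sq_int_mul mE v2 v2).
congr (_ + _); rewrite -RintegralZl//; by apply: eq_Rintegral => t _; ring.
Qed.

(** A square integrable representative of the residual [S u - yd]; it is not the initial state. *)
Let y0 u x := S0 u x + (S ctrl_zero x - yd x).

Let Sz_L2' : sq_int muX setT (fun x => S ctrl_zero x - yd x).
Proof.
have := sq_int_lin measurableT (-1) yd_L2 Sz_L2.
by congr sq_int; apply/funext => x; rewrite mulN1r addrC.
Qed.

Let y0_L2 u : L2c T u -> sq_int muX setT (y0 u).
Proof.
move=> uL; have := sq_int_lin measurableT 1 (S0_L2 uL) Sz_L2'.
by congr sq_int; apply/funext => x; rewrite mul1r.
Qed.

Let obs_ae u : L2c T u -> {ae muX, forall x, S u x - yd x = y0 u x}.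
Proof. by move=> /S_affine; apply: filterS => x ->; rewrite /y0 addrA. Qed.

Let obs_ip u v : L2c T u ->
  ipX muX (S0 v) (fun x => S u x - yd x) = ip muX setT (S0 v) (y0 u).
Proof. by move=> uL; apply: ae_eq_RintegralT; apply: filterS (obs_ae uL) => x ->. Qed.

Let obs_norm u : L2c T u ->
  ipX muX (fun x => S u x - yd x) (fun x => S u x - yd x) = ip muX setT (y0 u) (y0 u).
Proof. by move=> uL; apply: ae_eq_RintegralT; apply: filterS (obs_ae uL) => x ->. Qed.

Definition smooth_deriv u du v dv :=
  ipX muX (S0 v) (fun x => S u x - yd x) + alpha * ipc T u v + eps * ipc T du dv.

Lemma smooth_deriv_lin u du a v dv w dw :
    L2c T u -> L2c T du -> L2c T v -> L2c T dv -> L2c T w -> L2c T dw ->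
  smooth_deriv u du (ctrl_add (ctrl_scale a v) w) (ctrl_add (ctrl_scale a dv) dw) =
  a * smooth_deriv u du v dv + smooth_deriv u du w dw.
Proof.
move=> uL duL vL dvL wL dwL; rewrite /smooth_deriv !obs_ip// !ipc_linr//.
have -> : ip muX setT (S0 (ctrl_add (ctrl_scale a v) w)) (y0 u) =
    ip muX setT (fun x => a * S0 v x + S0 w x) (y0 u).
  by apply: ae_eq_RintegralT; apply: filterS (S0_lin a vL wL) => x ->.
by rewrite (ip_linl measurableT a (y0_L2 uL) (S0_L2 vL) (S0_L2 wL)); ring.
Qed.

Definition bilinear_part u v : R -> R := fun t => u.2 t * v.1 t + u.1 t * v.2 t.

Lemma Jbeta_line u du v dv s :
    L2c T u -> L2c T du -> L2c T v -> L2c T dv ->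
  Jbeta muX T S yd alpha eps beta
    (ctrl_add (ctrl_scale s v) u) (ctrl_add (ctrl_scale s dv) du) =
  Jbeta muX T S yd alpha eps beta u du + (s * smooth_deriv u du v dv +
  s ^+ 2 * (2^-1 * ipX muX (S0 v) (S0 v) + alpha / 2 * normc2 T v + eps / 2 * normc2 T dv) +
  beta * (\int[mu]_(t in E) `|u.1 t * u.2 t + s * bilinear_part u v t +
                             s ^+ 2 * (v.1 t * v.2 t)| -
          \int[mu]_(t in E) `|u.1 t * u.2 t|)).
Proof.
move=> uL duL vL dvL.
rewrite /Jbeta /smooth_deriv !normc2_line// !obs_norm ?obs_ip//; last exact: L2c_lin.
have -> : ip muX setT (y0 (ctrl_add (ctrl_scale s v) u))
      (y0 (ctrl_add (ctrl_scale s v) u)) =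
    ip muX setT (fun x => s * S0 v x + y0 u x) (fun x => s * S0 v x + y0 u x).
  apply: ae_eq_RintegralT; apply: filterS (S0_lin s vL uL) => x.
  by rewrite /y0 => ->; rewrite -!addrA.
rewrite (ip_line measurableT s (y0_L2 uL) (S0_L2 vL)) (ipC _ (y0 u) (S0 v)).
rewrite [\int[mu]_(t in E) `|_ * (ctrl_add _ _).2 _|](_ : _ =
    \int[mu]_(t in E) `|u.1 t * u.2 t + s * bilinear_part u v t +
                             s ^+ 2 * (v.1 t * v.2 t)|); last first.
  by apply: eq_Rintegral => t _; congr `|_|; rewrite /bilinear_part /=; ring.
by rewrite /ip /ipX; field.
Qed.

(** [U] relates a control to its time derivative, so one argument covers H^1 pairs and the pairs
    [(v, 0)] of a finite-dimensional space. *)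
Theorem subspace_stationarity (U : @ctrl R -> @ctrl R -> Prop) ub dub :
    0 < beta ->
    (forall v dv, U v dv -> L2c T v /\ L2c T dv) ->
    (forall a v dv w dw, U v dv -> U w dw ->
      U (ctrl_add (ctrl_scale a v) w) (ctrl_add (ctrl_scale a dv) dw)) ->
    U ub dub ->
    (exists delta : R, 0 < delta /\ forall v dv, U v dv ->
      normc2 T (ctrl_sub v ub) + normc2 T (ctrl_sub dv dub) < delta ->
      Jbeta muX T S yd alpha eps beta ub dub <= Jbeta muX T S yd alpha eps beta v dv) ->
  exists q : R -> R,
    [/\ measurable_fun E q,
        (exists M : R, {ae mu, forall t, E t -> `|q t| <= M}),
        {ae mu, forall t, E t -> in_beta_sign beta (ub.1 t * ub.2 t) (q t)} &
        forall v dv, U v dv -> ipX muX (S0 v) (fun x => S ub x - yd x) +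
          alpha * ipc T ub v + eps * ipc T dub dv +
          ipT T q (fun t => ub.2 t * v.1 t + ub.1 t * v.2 t) = 0].
Proof.
move=> b0 UL Ulin Uub [delta [delta0 loc]].
have [ubL dubL] := UL _ _ Uub.
pose p t := ub.1 t * ub.2 t.
(* The two strict tests disagree only at [p t = 0], where they give the full interval from [- beta]
   to [beta]. *)
pose lo t := if 0 < p t then beta else - beta.
pose hi t := if p t < 0 then - beta else beta.
have p1 : L1 mu E p := sq_int_mul mE ubL.1 ubL.2.
have l1 v : L2c T v -> L1 mu E (bilinear_part ub v).
  move=> vL; apply: L1_add => //.
    exact: (sq_int_mul mE ubL.2 vL.1).
  exact: (sq_int_mul mE ubL.1 vL.2).
have muE : (mu E < +oo)%E.
  by rewrite /tI lebesgue_measure_itv/=; case: ifP => _; rewrite ?ltry// -EFinB ltry.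
have mp := L1_measurable p1.
have mlo : measurable_fun E lo.
  by apply: measurable_fun_if => //; exact: measurable_fun_ltr.
have mhi : measurable_fun E hi.
  by apply: measurable_fun_if => //; exact: measurable_fun_ltr.
have lohi t : E t -> [/\ lo t <= hi t, `|lo t| <= beta & `|hi t| <= beta].
  move=> _; rewrite /lo /hi.
  by case: (ltgtP 0 (p t)) => _; rewrite ?normrN gtr0_norm//; split => //; lra.
pose K : set ((R -> R^o) * R) :=
  [set k | exists v dv, U v dv /\ k = (bilinear_part ub v, smooth_deriv ub dub v dv)].
have [|a _ _ [v [dv [Uv ->]]] [w [dw [Uw ->]]]|_ [v [dv [Uv ->]]]|q [mq qb qK]] :=
    L1_multiplier mE muE mlo mhi lohi (K := K).
- by exists (bilinear_part ub ub, smooth_deriv ub dub ub dub), ub, dub.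
- exists (ctrl_add (ctrl_scale a v) w), (ctrl_add (ctrl_scale a dv) dw).
  split; first exact: Ulin.
  have [[vL dvL] [wL dwL]] := (UL _ _ Uv, UL _ _ Uw).
  rewrite smooth_deriv_lin//; congr pair.
  apply/funext => t.
  transitivity (a * bilinear_part ub v t + bilinear_part ub w t); first by [].
  by rewrite /bilinear_part /=; ring.
- have [vL dvL] := UL _ _ Uv; split; first exact: l1.
  pose n := normc2 T v + normc2 T dv.
  have n0 : 0 <= n.
    rewrite /n /normc2 /ipc /ipT !addr_ge0//; apply: Rintegral_ge0 => t _;
      by rewrite -expr2 sqr_ge0.
  (* For [0 < s < 1] one has [s^2 n <= s (n + 1) < delta], which keeps [u + s v] in the
     neighbourhood; adding 1 keeps the denominator positive when [n = 0]. *)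
  pose s0 := Num.min 1 (delta / (n + 1)).
  have s00 : 0 < s0 by rewrite lt_min ltr01 divr_gt0// ltr_wpDl.
  apply: (abs_integral_stationary mE (ltW b0) s00 p1 (l1 _ vL)
    (sq_int_mul mE vL.1 vL.2)) => s /andP[s_gt0].
  rewrite lt_min ltr_pdivlMr ?ltr_wpDl// => /andP[s_lt1 s_lt].
  have := loc _ _ (Ulin s _ _ _ _ Uv Uub).
  rewrite !normc2_sub_line// -mulrDr -/n.
  rewrite Jbeta_line// lerDl; apply.
  apply: le_lt_trans s_lt.
  have : 0 <= n * (s * (1 - s)) by rewrite !mulr_ge0// ?subr_ge0 ltW.
  by rewrite expr2; nra.
have bsign t : E t -> in_beta_sign beta (p t) (q t).
  move=> /qb; rewrite /lo /hi => lqh; exists (q t / beta).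
  rewrite mulrCA divff ?lt0r_neq0// mulr1; split => //.
  split => pt; move: lqh; rewrite ?pt.
  - rewrite ltNge (ltW pt)/= => /le_anti <-.
    by rewrite divff ?lt0r_neq0.
  - rewrite ltNge (ltW pt)/= => /le_anti <-.
    by rewrite mulNr divff ?lt0r_neq0.
  - by rewrite ltxx ler_pdivlMr// ler_pdivrMr// mulN1r mul1r.
exists q; split => //.
- exists beta; apply: aeW => t /[dup] Et /qb /andP[loq qhi].
  have [_] := lohi _ Et.
  by rewrite !ler_norml => /andP[l _] /andP[_ h]; rewrite (le_trans l)//= (le_trans qhi).
- by apply: aeW => t /bsign.
- move=> v dv Uv; rewrite addrC.
  by apply: (qK (bilinear_part ub v, smooth_deriv ub dub v dv)); exists v, dv.
Qed.

End ReducedCost.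

(** * Linearity of H^1(0,T;R^2) and of finite-dimensional spans *)

Section ControlSpaces.
Context {R : realType} (T : R).
Local Notation mu := (@lebesgue_measure R).
Implicit Types u v w : @ctrl R.

Lemma continuous_sq_int (f : R -> R) : continuous f -> sq_int mu (tI T) f.
Proof.
move=> cf; split.
  by apply: measurable_funTS; exact: continuous_measurable_fun.
apply: continuous_compact_integrable; first exact: segment_compact.
apply: continuous_subspaceT => x; exact: (cvgM (cf x) (cf x)).
Qed.

(** Makes the products in [is_wderiv] integrable, so that its integrals can be split by
    linearity. *)
Lemma testfun_sq_int phi : testfun T phi ->
  sq_int mu (tI T) phi /\ sq_int mu (tI T) (derive1 phi).
Proof.
move=> [smooth _].
by split; apply: continuous_sq_int => x; apply: differentiable_continuous;
  apply/derivable1_diffP; [exact: (smooth 0)|exact: (smooth 1)].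
Qed.

Lemma is_wderiv_lin a f df g dg : is_wderiv T f df -> is_wderiv T g dg ->
  is_wderiv T (fun t => a * f t + g t) (fun t => a * df t + dg t).
Proof.
move=> [f2 df2 fE] [g2 dg2 gE].
have mE : @measurable _ (measurableTypeR R) (tI T) by exact: measurable_itv.
have sq h : L2f T h -> sq_int mu (tI T) h by [].
split; [exact: (sq_int_lin mE a (sq _ f2) (sq _ g2))|
        exact: (sq_int_lin mE a (sq _ df2) (sq _ dg2))|].
move=> phi phiT; have [p2 dp2] := testfun_sq_int phiT.
have := ip_linl mE a dp2 (sq _ f2) (sq _ g2).
have := ip_linl mE a p2 (sq _ df2) (sq _ dg2).
rewrite /ip => -> ->.
by rewrite fE// gE//; ring.
Qed.

Lemma H1c_lin a u du v dv : H1c T u du -> H1c T v dv ->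
  H1c T (ctrl_add (ctrl_scale a u) v) (ctrl_add (ctrl_scale a du) dv).
Proof. by move=> [u1 u2] [v1 v2]; split; exact: is_wderiv_lin. Qed.

Lemma H1c_L2c u du : H1c T u du -> L2c T u /\ L2c T du.
Proof. by move=> [[? ? _] [? ? _]]. Qed.

Lemma in_span_lin m (e : 'I_m -> ctrl) a u v : in_span T e u -> in_span T e v ->
  in_span T e (ctrl_add (ctrl_scale a u) v).
Proof.
move=> [uL [c cE]] [vL [c' c'E]]; split; first exact: L2c_lin.
have aeF : Filter (almost_everywhere mu) by exact: ae_filter_ringOfSetsType.
exists (fun k => a * c k + c' k); apply: filterS2 cE c'E => t ut vt Tt /=.
have [[-> ->] [-> ->]] := (ut Tt, vt Tt).
by split; rewrite mulr_sumr -big_split /=; apply: eq_bigr => k _; ring.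
Qed.

Lemma L2c_zero : L2c T ctrl_zero.
Proof. by split; apply: continuous_sq_int => x; exact: cvg_cst. Qed.

Lemma ctrl_zero_lin (a : R) : ctrl_add (ctrl_scale a ctrl_zero) ctrl_zero = ctrl_zero.
Proof. by rewrite /ctrl_add /ctrl_scale /=; congr pair; apply/funext => t; rewrite mulr0 addr0. Qed.

Lemma normc2_zero_sub : normc2 T (ctrl_sub ctrl_zero ctrl_zero) = 0.
Proof.
rewrite /normc2 /ipc /ipT /= subrr mul0r.
by rewrite Rintegral_cst ?mul0r ?addr0//; exact: measurable_itv.
Qed.

End ControlSpaces.

Theorem theorem3p1 (R : realType) (d : measure_display) (X : measurableType d)
    (muX : {measure set X -> \bar R}) (T : R) (S S0 : @ctrl R -> X -> R)
    (C : R) (yd : X -> R) (alpha beta : R) :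
  0 < T -> 0 < alpha -> alpha < beta ->
  L2X muX yd ->
  (* S0 : L^2(0,T;R^2) -> L^2(obs) linear and bounded *)
  (forall u, L2c T u -> L2X muX (S0 u)) ->
  (forall (a : R) u v, L2c T u -> L2c T v ->
     {ae muX, forall x, S0 (ctrl_add (ctrl_scale a u) v) x = a * S0 u x + S0 v x}) ->
  (forall u, L2c T u -> ipX muX (S0 u) (S0 u) <= C * normc2 T u) ->
  (* S is affine with linear part S0 *)
  L2X muX (S ctrl_zero) ->
  (forall u, L2c T u -> {ae muX, forall x, S u x = S0 u x + S ctrl_zero x}) ->
  (* case (i): U = H^1(0,T;R^2), eps > 0 *)
  (forall (eps : R) (ub dub : ctrl),
     0 < eps -> H1c T ub dub ->
     (exists delta : R, 0 < delta /\
        forall v dv, H1c T v dv ->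
          normc2 T (ctrl_sub v ub) + normc2 T (ctrl_sub dv dub) < delta ->
          Jbeta muX T S yd alpha eps beta ub dub
            <= Jbeta muX T S yd alpha eps beta v dv) ->
     exists q : R -> R,
       [/\ measurable_fun (tI T) q,
           (exists M : R, {ae @lebesgue_measure R, forall t, tI T t -> `|q t| <= M}),
           {ae @lebesgue_measure R, forall t, tI T t ->
              in_beta_sign beta (ub.1 t * ub.2 t) (q t)} &
           forall v dv, H1c T v dv ->
             ipX muX (S0 v) (fun x => S ub x - yd x) + alpha * ipc T ub v
             + eps * ipc T dub dv
             + ipT T q (fun t => ub.2 t * v.1 t + ub.1 t * v.2 t) = 0])
  /\
  (* case (ii): U finite-dimensional subspace of L^2(0,T;R^2), eps = 0 *)
  (forall (m : nat) (e : 'I_m -> ctrl) (ub : ctrl),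
     (forall k, L2c T (e k)) -> in_span T e ub ->
     (exists delta : R, 0 < delta /\
        forall v, in_span T e v -> normc2 T (ctrl_sub v ub) < delta ->
          Jbeta muX T S yd alpha 0 beta ub ctrl_zero
            <= Jbeta muX T S yd alpha 0 beta v ctrl_zero) ->
     exists q : R -> R,
       [/\ measurable_fun (tI T) q,
           (exists M : R, {ae @lebesgue_measure R, forall t, tI T t -> `|q t| <= M}),
           {ae @lebesgue_measure R, forall t, tI T t ->
              in_beta_sign beta (ub.1 t * ub.2 t) (q t)} &
           forall v, in_span T e v ->
             ipX muX (S0 v) (fun x => S ub x - yd x) + alpha * ipc T ub v
             + ipT T q (fun t => ub.2 t * v.1 t + ub.1 t * v.2 t) = 0]).
Proof.
move=> T0 a0 ab yd2 S0L2 S0lin S0bnd Sz Saff.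
have b0 : 0 < beta := lt_trans a0 ab.
have thm := subspace_stationarity yd2 S0L2 S0lin Sz Saff b0.
split=> [eps ub dub _ Hub loc|m e ub eL Hub [delta [delta0 loc]]].
  apply: (thm alpha eps (H1c T)) => //; first exact: H1c_L2c.
  by move=> a v dv w dw; exact: H1c_lin.
(* The derivative entry is frozen at zero and [eps = 0], so the derivative terms vanish. *)
have [||||q [mq qM qs qE]] := thm alpha 0 (fun v dv => in_span T e v /\ dv = ctrl_zero) ub ctrl_zero.
- by move=> v dv [[vL _] ->]; split => //; exact: L2c_zero.
- move=> a v dv w dw [vs ->] [ws ->]; rewrite ctrl_zero_lin.
  by split => //; exact: in_span_lin.
- by [].
- exists delta; split => // v dv [vs ->]; rewrite normc2_zero_sub addr0.
  exact: loc.
exists q; split => // v vs.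
by have := qE v ctrl_zero (conj vs erefl); rewrite mul0r addr0.
Qed.
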